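(* Let $\mathcal{I}$ be a meager ideal on $\omega$. Then $c_0(\mathcal{I})\cap\ell_\infty$ is not complemented in $\ell_\infty$, and $c_0(\mathcal{I})\cap\ell_\infty$ is not isomorphic to $\ell_\infty$.
   Context: An ideal on $\omega$ is a family $\mathcal{I}\subseteq\mathcal{P}(\omega)$ closed under subsets and finite unions; it is also assumed that every finite subset of $\omega$ belongs to $\mathcal{I}$ and that $\omega\notin\mathcal{I}$. An ideal is regarded as a subset of the Cantor space $2^\omega$ with the product topology (identifying sets with characteristic functions), and is meager if it is a meager (first category) subset of $2^\omega$. A real sequence $(x_n)_{n\in\omega}$ is $\mathcal{I}$-convergent to $y\in\mathbb{R}$ if $\{n: x_n\notin U\}\in\mathcal{I}$ for every neighborhood $U$ of $y$. $c_0(\mathcal{I})$ is the space of real sequences that are $\mathcal{I}$-convergent to $0$. $\ell_\infty$ is the Banach space of bounded real sequences indexed by $\omega$ with the sup norm; $c_0(\mathcal{I})\cap\ell_\infty$ is a closed linear subspace of it, equipped with the sup norm. A closed subspace $X$ of a Banach space $B$ is complemented in $B$ if there exists a continuous (linear) projection from $B$ onto $X$. Isomorphic means isomorphic as Banach spaces, i.e. there is a linear homeomorphism between the spaces (not necessarily an isometry). *)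

(* Defs.v *)
From HB Require Import structures.
From mathcomp Require Import all_boot all_order all_algebra.
From mathcomp Require Import all_classical all_reals all_analysis.
From mathcomp Require Import lra.
Set Implicit Arguments.
Unset Strict Implicit.
Unset Printing Implicit Defensive.
Import Order.TTheory GRing.Theory Num.Theory.
Import numFieldNormedType.Exports.
Local Open Scope classical_set_scope.
Local Open Scope ring_scope.

Definition nowhere_dense (T : topologicalType) (A : set T) : Prop :=
  (closure A)° = set0.

Definition meager (T : topologicalType) (A : set T) : Prop :=
  exists F : nat -> set T,
    (forall n, nowhere_dense (F n)) /\ A `<=` \bigcup_n F n.

Record ideal := Ideal {
  ideal_set : set (set nat);
  idealS : forall A B : set nat, A `<=` B -> ideal_set B -> ideal_set A;
  idealU : forall A B : set nat,
    ideal_set A -> ideal_set B -> ideal_set (A `|` B);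
  ideal_fin : forall A : set nat, finite_set A -> ideal_set A;
  ideal_proper : ~ ideal_set setT }.

(* The members of the ideal, identified with their characteristic functions. *)
Definition ideal_cantor (I : ideal) : set cantor_space :=
  [set f : cantor_space | ideal_set I [set n | f n]].

Definition I_cvg (R : realType) (I : ideal) (x : nat -> R) (y : R) : Prop :=
  forall U : set R, nbhs y U -> ideal_set I [set n | ~ U (x n)].

Section SubNormed.
Context (K : numFieldType) (V : normedModType K) (S : submodClosed V).

(* A linear subspace as a space of its own, with the norm induced from V. *)
Definition subnormed : Type := {x : V | x \in S}.

HB.instance Definition _ := [isSub of subnormed for @sval V (fun x => x \in S)].
HB.instance Definition _ := [Choice of subnormed by <:].
HB.instance Definition _ := [SubChoice_isSubLmodule of subnormed by <:].

Let nrm (x : subnormed) : K := `|val x|.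

Let nrmD x y : nrm (x + y) <= nrm x + nrm y.
Proof. exact: ler_normD. Qed.

Let nrmZ (l : K) x : nrm (l *: x) = `|l| * nrm x.
Proof. exact: normrZ. Qed.

Let nrm0 x : nrm x = 0 -> x = 0.
Proof. by move=> /normr0_eq0 x0; apply: val_inj. Qed.

HB.instance Definition _ := @Lmodule_isNormed.Build K subnormed nrm nrmD nrmZ nrm0.
End SubNormed.

Section linfty.
Context (R : realType).

Definition bounded_seq : {pred nat -> R} := [pred x | `[< bounded_fun x >]].

Lemma bounded_seqP (x : nat -> R) :
  reflect (exists M, forall n, `|x n| <= M) (x \in bounded_seq).
Proof.
apply: (iffP (asboolP _)) => [[N [_ xN]]|[M xM]].
  by exists (N + 1) => n; apply: xN => //; rewrite ltrDl.
exists M; split; first exact: num_real.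
by move=> N /ltW MN n _; exact: le_trans (xM n) MN.
Qed.

Lemma bounded_seq_submod : submod_closed bounded_seq.
Proof.
split; first by apply/bounded_seqP; exists 0 => n; rewrite normr0.
move=> a x y /bounded_seqP[M xM] /bounded_seqP[N yN]; apply/bounded_seqP.
exists (`|a| * M + N) => n.
by rewrite (le_trans (ler_normD _ _))// lerD// normrM ler_wpM2l.
Qed.
HB.instance Definition _ :=
  GRing.isSubmodClosed.Build R (nat -> R) bounded_seq bounded_seq_submod.

Definition linfty : Type := {x : nat -> R | x \in bounded_seq}.

HB.instance Definition _ := [isSub of linfty for @sval (nat -> R) (fun x => x \in bounded_seq)].
HB.instance Definition _ := [Choice of linfty by <:].
HB.instance Definition _ := [SubChoice_isSubLmodule of linfty by <:].

Definition supnorm (x : linfty) : R := sup (range (fun n => `|val x n|)).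

Lemma supnorm_ge (x : linfty) n : `|val x n| <= supnorm x.
Proof.
apply: ub_le_sup; last by exists n.
have /bounded_seqP[M xM] := valP x.
by exists M => _ [k _ <-]; exact: xM.
Qed.

Lemma supnorm_le (x : linfty) M : (forall n, `|val x n| <= M) -> supnorm x <= M.
Proof.
move=> xM; apply: ge_sup; first by exists `|val x 0|, 0%N.
by move=> _ [n _ <-]; exact: xM.
Qed.

Let supnormD (x y : linfty) : supnorm (x + y) <= supnorm x + supnorm y.
Proof.
by apply: supnorm_le => n; rewrite (le_trans (ler_normD _ _))// lerD// supnorm_ge.
Qed.

Let supnormZ (l : R) (x : linfty) : supnorm (l *: x) = `|l| * supnorm x.
Proof.
apply/eqP; rewrite eq_le; apply/andP; split.
  by apply: supnorm_le => n; rewrite normrM ler_wpM2l// supnorm_ge.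
have [->|l0] := eqVneq l 0.
  by rewrite normr0 mul0r (le_trans _ (supnorm_ge _ 0%N)).
rewrite -ler_pdivlMl ?normr_gt0//; apply: supnorm_le => n.
rewrite ler_pdivlMl ?normr_gt0// -normrM.
exact: (supnorm_ge (l *: x) n).
Qed.

Let supnorm0 (x : linfty) : supnorm x = 0 -> x = 0.
Proof.
move=> x0; apply: val_inj; apply/funext => n; apply/eqP.
by rewrite -normr_le0 -x0 supnorm_ge.
Qed.

HB.instance Definition _ :=
  @Lmodule_isNormed.Build R linfty supnorm supnormD supnormZ supnorm0.

Lemma linfty_norm_ge (x : linfty) n : `|val x n| <= `|x|.
Proof. exact: supnorm_ge. Qed.

Lemma linfty_norm_le (x : linfty) M : (forall n, `|val x n| <= M) -> `|x| <= M.
Proof. exact: supnorm_le. Qed.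

Let linfty_complete (F : set_system linfty) :
  ProperFilter F -> cauchy F -> cvg F.
Proof.
move=> FF Fc.
have Fpt n : cvg ((fun x : linfty => val x n) @ F).
  apply/cauchy_cvgP/cauchy_exP => e e0.
  have /cauchyP/(_ e e0)[x Fx] := Fc.
  exists (val x n); rewrite /=; apply: filterS Fx => y.
  rewrite -!ball_normE/= => xy; apply: le_lt_trans xy.
  exact: (linfty_norm_ge (x - y)).
pose l n : R := lim ((fun x : linfty => val x n) @ F).
have near_l e (x : linfty) : F (ball x e) -> forall n, `|val x n - l n| <= e.
  move=> Fx n.
  have cl : `|val x n - val y n| @[y --> F] --> `|val x n - l n|.
    by apply: cvg_norm; apply: cvgB; [exact: cvg_cst|exact: Fpt].
  rewrite -(cvg_lim (@Rhausdorff R) cl); apply: limr_le.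
    by apply/cvg_ex; exists `|val x n - l n|.
  apply: filterS Fx => y; rewrite -ball_normE/= => /ltW; apply: le_trans.
  exact: (linfty_norm_ge (x - y)).
have lb : l \in bounded_seq.
  have /cauchyP/(_ 1 ltr01)[x Fx] := Fc.
  apply/bounded_seqP; exists (1 + `|x|) => n.
  rewrite -[l n](subrK (val x n)) (le_trans (ler_normD _ _))// lerD//.
    by rewrite distrC; exact: near_l.
  exact: linfty_norm_ge.
apply/cvg_ex; exists (exist _ l lb : linfty).
apply/cvg_ballP => e e0.
have e4 : 0 < e / 4 by rewrite divr_gt0.
have /cauchyP/(_ _ e4)[x Fx] := Fc.
near=> y.
have yx : ball x (e / 4) y by near: y.
rewrite -ball_normE/=.
apply: (@le_lt_trans _ _ (e / 4 + e / 4)); last by lra.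
apply: linfty_norm_le => n.
rewrite (_ : val _ n = (l n - val x n) + (val x n - val y n)); last first.
  by rewrite addrA subrK.
rewrite (le_trans (ler_normD _ _))// lerD//; first by rewrite distrC near_l.
move: yx; rewrite -ball_normE/= => /ltW; apply: le_trans.
exact: (linfty_norm_ge (x - y)).
Unshelve. all: by end_near. Qed.

HB.instance Definition _ := Uniform_isComplete.Build linfty linfty_complete.

End linfty.

Section c0.
Context (R : realType) (I : ideal).

(* c_0(I) intersected with linfty. *)
Definition c0_linfty : {pred linfty R} :=
  [pred x : linfty R | `[< I_cvg I (val x) 0 >]].

Lemma c0_submod : submod_closed c0_linfty.
Proof.
split.
  apply/asboolP => U U0; apply: (idealS _ (@ideal_fin I set0 _)) => //.
  by move=> n /=; apply; exact: nbhs_singleton.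
move=> a x y /asboolP cx /asboolP cy; apply/asboolP => U /nbhs_ballP[e/= e0 eU].
pose d := e / 2 / (`|a| + 1).
have a1 : 0 < `|a| + 1 by rewrite ltr_wpDl.
have d0 : 0 < d by rewrite !divr_gt0.
have e20 : 0 < e / 2 by rewrite divr_gt0.
apply: (idealS _ (idealU (cx _ (nbhsx_ballx 0 d d0))
                         (cy _ (nbhsx_ballx 0 (e / 2) e20)))).
move=> n /=; rewrite -not_andP => nU [bx by_]; apply: nU; apply: eU.
move: bx by_; rewrite -!ball_normE/= !sub0r !normrN => bx by_.
rewrite (le_lt_trans (ler_normD _ _))// [ltRHS]splitr ltr_leD//; last exact: ltW.
rewrite normrM (@le_lt_trans _ _ ((`|a| + 1) * `|val x n|))//.
  by rewrite ler_wpM2r// lerDl.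
by rewrite mulrC -ltr_pdivlMr.
Qed.
HB.instance Definition _ :=
  GRing.isSubmodClosed.Build R (linfty R) c0_linfty c0_submod.

Lemma c0_linfty_closed : closed [set x | x \in c0_linfty].
Proof.
move=> x clx; apply/asboolP => U /nbhs_ballP[e/= e0 eU].
have e20 : 0 < e / 2 by rewrite divr_gt0.
have [y [/asboolP cy xy]] := clx _ (nbhsx_ballx x _ e20).
apply: (idealS _ (cy _ (nbhsx_ballx 0 (e / 2) e20))) => n /= nU yn.
apply: nU; apply: eU; move: yn xy; rewrite -!ball_normE/= !sub0r !normrN => yn xy.
rewrite -[val x n](subrK (val y n)) (le_lt_trans (ler_normD _ _))//.
rewrite [ltRHS]splitr ler_ltD//; apply: le_trans (ltW xy).
exact: (linfty_norm_ge (x - y)).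
Qed.

End c0.
Arguments c0_linfty : clear implicits.

Definition complemented (K : numFieldType) (B : completeNormedModType K)
    (X : submodClosed B) : Prop :=
  exists P : {linear B -> B},
    [/\ continuous P, P \o P = P & range P = [set x | x \in X]].

Definition isomorphic (K : numFieldType) (V W : normedModType K) : Prop :=
  exists (f : {linear V -> W}) (g : {linear W -> V}),
    [/\ continuous f, continuous g, cancel f g & cancel g f].

(* Main.v *)
From HB Require Import structures.
Require Import Defs.
From mathcomp Require Import all_boot all_order all_algebra.
From mathcomp Require Import all_classical all_reals all_analysis.
From mathcomp Require Import ring lra.
Import numFieldNormedType.Exports.

(** Write X for the bounded sequences that converge to 0 along the ideal I.

    X is not complemented by Whitley's argument for c_0.  If P were a bounded
    projection onto X, then T = id - P would be a bounded operator on l_infty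
    whose kernel is X.  So T kills every finitely supported sequence, but not
    the indicator of a set outside I.  Suppose there is an uncountable family
    of sets outside I with finite pairwise intersections.  By pigeonhole,
    infinitely many of their indicators have an image under T whose coordinate
    at one and the same index exceeds one and the same 1/(k+1) in modulus.
    Choosing signs so that these coordinates add up, and correcting on the
    finite overlaps, which T ignores, yields sequences of norm at most 1 whose
    images under T have norm at least N/(k+1) for every N, against the
    boundedness of T ([vanish_almost_disjoint]).

    Meagerness of I provides the family.  If I is covered by nowhere dense
    sets F_0, F_1, ..., then omega can be cut into consecutive finite blocks,
    each with a pattern, such that a set that follows the pattern on infinitely
    many blocks lies in no F_k, hence not in I ([meager_blocks]; this is the
    Jalali-Naini--Talagrand description of meager ideals).  Following the
    pattern exactly on the blocks numbered by the initial segments of a branch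
    of the binary tree gives one such set for each branch, and two branches
    share only finitely many initial segments
    ([ideal_almost_disjoint_family]).

    X is not isomorphic to l_infty because l_infty is injective: an
    isomorphism f from X onto l_infty extends to a bounded operator F on
    l_infty, by the Hahn-Banach theorem applied to each coordinate of f, and
    then the inverse of f composed with F is a projection onto X
    ([isomorphic_complemented]). *)

Set Implicit Arguments.
Unset Strict Implicit.
Unset Printing Implicit Defensive.
Import Order.TTheory GRing.Theory Num.Theory.
Local Open Scope classical_set_scope.
Local Open Scope ring_scope.

(** * The Hahn-Banach theorem *)

Section HahnBanach.
Context (R : realType) (V : lmodType R) (p : V -> R).
Hypothesis p_add : forall x y, p (x + y) <= p x + p y.
Hypothesis p_scale : forall (t : R) x, 0 <= t -> p (t *: x) = t * p x.

(** Partially defined linear functionals are represented by their graphs.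
    Single-valuedness comes for free: a linear relation that lies below a
    sublinear functional is the graph of a function ([below_functional]). *)
Definition lin_rel (G : set (V * R)) : Prop :=
  forall (a : R) x r y s, G (x, r) -> G (y, s) -> G (a *: x + y, a * r + s).

Definition below (G : set (V * R)) : Prop := forall x r, G (x, r) -> r <= p x.

Let p0 : p 0 = 0.
Proof. by rewrite -(scale0r (0 : V)) p_scale// mul0r. Qed.

Let lin_rel0 G x r : lin_rel G -> G (x, r) -> G (0, 0).
Proof.
by move=> Glin Gx; have := Glin (- 1) _ _ _ _ Gx Gx; rewrite scaleN1r mulN1r !addNr.
Qed.

(** Two values r and s at x make r - s and s - r values at 0, where p is 0. *)
Lemma below_functional G x r s : lin_rel G -> below G ->
  G (x, r) -> G (x, s) -> r = s.
Proof.
move=> Glin Gp Gr Gs; apply/eqP; rewrite eq_le.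
have := Gp _ _ (Glin (- 1) _ _ _ _ Gr Gs).
have := Gp _ _ (Glin (- 1) _ _ _ _ Gs Gr).
by rewrite scaleN1r addNr p0; lra.
Qed.

Definition extend (G : set (V * R)) (v : V) (c : R) : set (V * R) :=
  [set z | exists x r t, G (x, r) /\ z = (x + t *: v, r + t * c)].

Lemma lin_rel_extend G v c : lin_rel G -> lin_rel (extend G v c).
Proof.
move=> Glin a x r y s [x1 [r1 [t1 [G1 [-> ->]]]]] [x2 [r2 [t2 [G2 [-> ->]]]]].
exists (a *: x1 + x2), (a * r1 + r2), (a * t1 + t2).
split; first exact: Glin.
congr (_, _); last by ring.
by rewrite scalerDr scalerDl scalerA addrACA.
Qed.

(** The value c at v is admissible when r - p (x - v) <= c <= p (y + v) - s for
    all (x, r) and (y, s) in G, and the sublinearity of p separates these two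
    families of bounds.  Multiples t *: v of either sign are reduced to v and
    - v by homogeneity. *)
Lemma one_step_extension G v : lin_rel G -> below G -> G !=set0 ->
  exists c, below (extend G v c).
Proof.
move=> Glin Gp [[x0 r0] Gx0].
have Gsep x r y s : G (x, r) -> G (y, s) -> r - p (x - v) <= p (y + v) - s.
  move=> Gx Gy; have := Gp _ _ (Glin 1 _ _ _ _ Gx Gy).
  rewrite scale1r mul1r => /le_trans/(_ (_ : _ <= p (x - v) + p (y + v))).
  have -> : x + y = (x - v) + (y + v) by rewrite addrACA addNr addr0.
  by move=> /(_ (p_add _ _)); lra.
pose D := [set d | exists x r, G (x, r) /\ d = r - p (x - v)].
have D0 : D !=set0 by exists (r0 - p (x0 - v)), x0, r0.
have lbD x r : G (x, r) -> r - p (x - v) <= sup D.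
  move=> Gx; apply: ub_le_sup; last by exists x, r.
  by exists (p (x0 + v) - r0) => _ [y [s [Gy ->]]]; exact: Gsep.
have ubD y s : G (y, s) -> sup D <= p (y + v) - s.
  by move=> Gy; apply: ge_sup => // _ [x [r [Gx ->]]]; exact: Gsep.
exists (sup D) => _ _ [x [r [t [Gx [-> ->]]]]].
have Gz : G (0, 0) := lin_rel0 Glin Gx.
have Gs a : G (a *: x, a * r).
  by have := Glin a _ _ _ _ Gx Gz; rewrite !addr0.
have [t0|t0|->] := ltgtP t 0.
- have u0 : 0 < - t by rewrite oppr_gt0.
  have := lbD _ _ (Gs (- t)^-1).
  have -> : x + t *: v = (- t) *: ((- t)^-1 *: x - v).
    by rewrite scalerBr scalerA divff ?gt_eqF// scale1r scaleNr opprK.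
  rewrite (p_scale _ (ltW u0)) => le.
  have := ler_wpM2l (ltW u0) le.
  by rewrite mulrBr mulrA divff ?gt_eqF// mul1r; lra.
- have := ubD _ _ (Gs t^-1).
  have -> : x + t *: v = t *: (t^-1 *: x + v).
    by rewrite scalerDr scalerA divff ?gt_eqF// scale1r.
  rewrite (p_scale _ (ltW t0)) => le.
  have := ler_wpM2l (ltW t0) le.
  by rewrite mulrBr [t * (t^-1 * r)]mulrA divff ?gt_eqF// mul1r; lra.
- by rewrite scale0r mul0r !addr0; exact: Gp.
Qed.

(** By Zorn's lemma; a maximal graph has full domain, since otherwise the
    one-step extension would enlarge it. *)
Lemma maximal_extension G0 : lin_rel G0 -> below G0 -> G0 !=set0 ->
  exists G, [/\ lin_rel G, below G, G0 `<=` G & forall v, exists r, G (v, r)].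
Proof.
move=> G0lin G0p G0n.
(* The empty graph is allowed, because it is the union of the empty chain. *)
pose P G := [/\ lin_rel G, below G & G !=set0 -> G0 `<=` G].
have [F FP Ftot|A [[Alin Ap A0] Amax]] := @Zorn_bigcup _ P.
  split.
  - move=> a x r y s [G1 F1 Gx] [G2 F2 Gy].
    have [s12|s21] := Ftot _ _ F1 F2.
      by exists G2 => //; have [+ _ _] := FP _ F2; apply => //; exact: s12.
    by exists G1 => //; have [+ _ _] := FP _ F1; apply => //; exact: s21.
  - by move=> x r [G FG Gx]; have [_ + _] := FP _ FG; exact.
  - move=> [z [G FG Gz]] w G0w; exists G => //.
    by have [_ _] := FP _ FG; apply => //; exists z.
have An : A !=set0.
  apply: contrapT => /nonemptyPn A00.
  apply: (Amax G0); last by split=> // _ z.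
  by rewrite A00; split=> // G00; case: G0n => z /G00.
exists A; split => // [|v]; first exact: A0.
apply: contrapT => Av; have [c cp] := one_step_extension v Alin Ap An.
have sub : A `<=` extend A v c.
  by move=> [x r] Ax; exists x, r, 0; rewrite scale0r mul0r !addr0.
apply: (Amax (extend A v c)).
  split=> // eA; apply: Av; exists c; apply: eA.
  case: An => -[x r] /(lin_rel0 Alin) Az.
  by exists 0, 0, 1; rewrite scale1r mul1r !add0r.
split => //; first exact: lin_rel_extend.
by move=> _; apply: subset_trans sub; exact: A0.
Qed.

(** The subspace is given by a linear map j into V instead of a predicate on V.
    The domination of f by p \o j makes f vanish on the kernel of j, so that f
    is a functional on the image of j. *)
Theorem hahn_banach (U : lmodType R) (j : {linear U -> V}) (f : {scalar U}) :
  (forall u, f u <= p (j u)) ->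
  exists F : {scalar V}, (forall x, F x <= p x) /\ (forall u, F (j u) = f u).
Proof.
move=> fp; pose G0 := [set z | exists u, z = (j u, f u)].
have [| | |G [Glin Gp G0G Gtot]] := @maximal_extension G0.
- move=> a _ _ _ _ [u [-> ->]] [w [-> ->]].
  by exists (a *: u + w); rewrite !linearP.
- by move=> _ _ [u [-> ->]].
- by exists (j 0, f 0), 0.
have [F FG] := choice Gtot.
have Fs : scalar F.
  by move=> a x y; apply: (below_functional Glin Gp (FG _)); exact: Glin.
pose Fl := HB.pack F (GRing.isLinear.Build R V R *%R F Fs) : {scalar V}.
exists Fl; split => [x|u]; first exact: Gp.
by apply: (below_functional Glin Gp (FG _)); apply: G0G; exists u.
Qed.
End HahnBanach.

(** * Injectivity of l_infty *)

Section injective.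
Context (R : realType).

(** A map into l_infty is a uniformly bounded sequence of functionals, and
    Hahn-Banach extends each of them without increasing the bound. *)
Lemma linfty_injective (U : lmodType R) (V : normedModType R)
    (j : {linear U -> V}) (f : {linear U -> linfty R}) (M : R) :
    0 <= M -> (forall u, `|f u| <= M * `|j u|) ->
  exists F : {linear V -> linfty R},
    (forall x, `|F x| <= M * `|x|) /\ (forall u, F (j u) = f u).
Proof.
move=> M0 fM; pose p (x : V) := M * `|x|.
have p_add x y : p (x + y) <= p x + p y.
  by rewrite /p -mulrDr ler_wpM2l// ler_normD.
have p_scale (t : R) x : 0 <= t -> p (t *: x) = t * p x.
  by move=> t0; rewrite /p normrZ ger0_norm// mulrCA.
have ext n : exists F : {scalar V},
    (forall x, F x <= p x) /\ (forall u, F (j u) = val (f u) n).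
  have fs : scalar (fun u => val (f u) n) by move=> a x y; rewrite linearP.
  pose fn := HB.pack (fun u => val (f u) n)
    (GRing.isLinear.Build R U R *%R _ fs) : {scalar U}.
  apply: (hahn_banach p_add p_scale (f := fn)) => u /=.
  exact: le_trans (ler_norm _) (le_trans (linfty_norm_ge _ _) (fM u)).
have [F FP] := choice ext.
have Fb x n : `|F n x| <= M * `|x|.
  have [Fp _] := FP n; rewrite ler_norml Fp andbT.
  by have := Fp (- x); rewrite linearN /p normrN; lra.
have Fx x : (fun n => F n x) \in @bounded_seq R.
  by apply/bounded_seqP; exists (M * `|x|).
pose E x : linfty R := exist (fun y => y \in @bounded_seq R) _ (Fx x).
have Es : linear E.
  by move=> a x y; apply: val_inj; apply/funext => n /=; rewrite linearP.
pose El := HB.pack E (GRing.isLinear.Build R V (linfty R) *:%R E Es)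
  : {linear V -> linfty R}.
exists El; split => [x|u]; first by apply: linfty_norm_le => n; exact: Fb.
by apply: val_inj; apply/funext => n; exact: (FP n).2.
Qed.

Lemma continuous_linear_bound (V W : normedModType R) (f : {linear V -> W}) :
  continuous f -> exists2 M, 0 <= M & forall x, `|f x| <= M * `|x|.
Proof.
move=> /linear_bounded_continuous/linear_boundedP/pinfty_ex_gt0[M M0 fM].
by exists M => //; exact: ltW.
Qed.

(** The projection is g \o F, where F extends the isomorphism f to all of B and
    g is the inverse of f. *)
Lemma isomorphic_complemented (B : completeNormedModType R) (X : submodClosed B) :
  isomorphic (subnormed X) (linfty R) -> complemented X.
Proof.
move=> [f [g [fc gc fK gK]]].
have [M M0 fM] := continuous_linear_bound fc.
have [F [FM Ff]] := linfty_injective (j := \val) M0 fM.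
pose P : {linear B -> B} := \val \o (g \o F).
have PX x : x \in X -> P x = x.
  move=> xX; pose u : subnormed X := exist _ x xX.
  have Fu : F x = f u := Ff u.
  by rewrite /P /= Fu fK.
have XP x : P x \in X by exact: valP.
have [N N0 gN] := continuous_linear_bound gc.
exists P; split.
- apply/linear_bounded_continuous/linear_boundedP; near=> r => x.
  apply: (@le_trans _ _ (N * (M * `|x|))).
    by apply: le_trans (gN _) _; rewrite ler_wpM2l.
  rewrite mulrA ler_wpM2r//; near: r; apply: nbhs_pinfty_ge.
- by apply/funext => x; exact: PX (XP x).
- apply/seteqP; split => [_ [x _ <-]|x xX]; first exact: XP.
  by exists x => //; exact: PX.
Unshelve. all: by end_near. Qed.
End injective.

(** * Operators that vanish on finitely supported sequences *)

Section whitley.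
Context (R : realType).

Lemma indic_bounded (A : set nat) : (\1_A : nat -> R) \in @bounded_seq R.
Proof.
apply/bounded_seqP; exists 1 => n.
by rewrite indicE; case: (_ \in _); rewrite ?normr1 ?normr0.
Qed.

Definition indic_linfty (A : set nat) : linfty R :=
  exist (fun y => y \in @bounded_seq R) _ (indic_bounded A).

(** Whitley's argument.  If no T (indic_linfty (B f)) is 0, uncountability of J
    yields a coordinate n and a k such that the n-th coordinate exceeds
    1/(k+1) in modulus for infinitely many f.  Signed sums of N of these
    indicators have norm at most 1 up to a finitely supported error, while the
    n-th coordinate of their image reaches N/(k+1). *)
Lemma vanish_almost_disjoint (J : Type) (B : J -> set nat)
    (T : {linear linfty R -> linfty R}) :
    ~ countable [set: J] ->
    (forall f g, f <> g -> finite_set (B f `&` B g)) ->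
    continuous T ->
    (forall x, finite_set [set n | val x n != 0] -> T x = 0) ->
  exists f, T (indic_linfty (B f)) = 0.
Proof.
move=> Junc Bad Tc T0; apply: contrapT => /forallNP Tn0.
have [M M0 TM] := continuous_linear_bound Tc.
have /choice[nk nkP] f : exists nk : nat * nat,
    nk.2.+1%:R^-1 < `|val (T (indic_linfty (B f))) nk.1|.
  have /existsNP[n /eqP nz] :
      ~ forall n, val (T (indic_linfty (B f))) n = 0.
    by move=> E; apply: (Tn0 f); apply: val_inj; apply/funext.
  have /ltr_add_invr[k] : 0 < `|val (T (indic_linfty (B f))) n|.
    by rewrite normr_gt0.
  by rewrite add0r => kn; exists (n, k).
have [[n k] inf] : exists nk0, infinite_set [set f | nk f = nk0].
  apply: contrapT => /forallNP fin; apply: Junc.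
  have -> : [set: J] = \bigcup_(i in [set: nat * nat]) [set f | nk f = i].
    by apply/seteqP; split => // f _; exists (nk f).
  apply: bigcup_countable => // i _; apply: finite_set_countable.
  exact: contrapT (fin i).
(* F collects the indices used so far; each unused B g must meet the support of
   w in a finite set, so that overwriting w on B g and adding a multiple of the
   indicator of B g to w differ by a finitely supported sequence. *)
have grow N : exists (F : set J) (w : linfty R),
    [/\ finite_set F, `|w| <= 1,
      forall g, ~ F g -> finite_set (B g `&` [set i | val w i != 0]) &
      N%:R * k.+1%:R^-1 <= val (T w) n].
  elim: N => [|N [F [w [Ffin w1 wF Tw]]]].
    exists set0, 0; split; rewrite ?normr0 ?mul0r ?linear0//.
    move=> g _; rewrite (_ : _ `&` _ = set0)//.
    by apply/seteqP; split => // i [_ /=]; rewrite eqxx.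
  have [f [ff nFf]] := infinite_setN0 (infinite_setD inf Ffin).
  pose e : R := Num.sg (val (T (indic_linfty (B f))) n).
  (* Overwriting w by e on B f keeps the norm at most 1, unlike adding e. *)
  pose v i := if i \in B f then e else val w i.
  have e1 : `|e| <= 1 by rewrite normr_sg; case: (_ != _).
  have v1 i : `|v i| <= 1.
    by rewrite /v; case: ifP => // _; exact: le_trans (linfty_norm_ge _ _) w1.
  have vb : v \in @bounded_seq R by apply/bounded_seqP; exists 1.
  pose w' : linfty R := exist (fun y => y \in @bounded_seq R) v vb.
  exists (F `|` [set f]), w'; split.
  - by rewrite finite_setU.
  - exact: linfty_norm_le.
  - move=> g /not_orP[nFg gf].
    apply: (@sub_finite_set _ _
      ((B g `&` [set i | val w i != 0]) `|` (B f `&` B g))).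
      move=> i [gi] /=; rewrite /v; case: ifPn => [/set_mem fi _|_ wi].
        by right.
      by left.
    rewrite finite_setU; split; first exact: wF.
    by apply: Bad => fg; apply: gf; rewrite fg.
  - have : T (w' - (w + e *: indic_linfty (B f))) = 0.
      apply: T0; apply: sub_finite_set (wF _ nFf) => i.
      rewrite [X in X -> _]/(is_true (v i - (val w i + e * \1_(B f) i) != 0)).
      rewrite /v indicE; case: ifPn => [/set_mem fi|nfi].
        by rewrite mulr1 opprD addrCA subrr addr0 oppr_eq0.
      by rewrite mulr0 addr0 subrr eqxx.
    rewrite linearB linearD linearZ/= => /eqP; rewrite subr_eq0 => /eqP ->.
    rewrite -[X in _ <= X]/(val (T w) n + e * val (T (indic_linfty (B f))) n).
    rewrite -natr1 mulrDl mul1r lerD//.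
    rewrite /e -normrEsg ltW//; have := nkP f.
    by rewrite ff.
have MN N : N%:R * k.+1%:R^-1 <= M.
  have [F [w [_ w1 _ /le_trans]]] := grow N; apply.
  apply: le_trans (ler_norm _) _; apply: le_trans (linfty_norm_ge _ _) _.
  by apply: le_trans (TM _) _; rewrite ler_piMr.
have := MN (Num.bound (M * k.+1%:R)); apply/negP.
rewrite -ltNge ltr_pdivlMr//.
by apply: archi_boundP; rewrite mulr_ge0.
Qed.

Lemma finite_support_c0 (I : ideal) (x : linfty R) :
  finite_set [set n | val x n != 0] -> x \in c0_linfty R I.
Proof.
move=> xfin; apply/asboolP => U /nbhs_singleton U0.
apply: ideal_fin; apply: sub_finite_set xfin => n /= nU.
by apply: contra_notN nU => /eqP ->.
Qed.

Lemma indic_c0 (I : ideal) (A : set nat) :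
  indic_linfty A \in c0_linfty R I -> ideal_set I A.
Proof.
move=> /asboolP/(_ _ (nbhsx_ballx 0 1 ltr01)); apply: idealS => n An /=.
rewrite -ball_normE /= indicE mem_set//.
by rewrite sub0r normrN normr1 ltxx.
Qed.

(** For a projection P onto c_0(I) /\ l_infty, the operator id - P vanishes on
    that space only, and so on the indicators of members of I only. *)
Lemma not_complemented_c0 (J : Type) (I : ideal) (B : J -> set nat) :
    ~ countable [set: J] ->
    (forall f g, f <> g -> finite_set (B f `&` B g)) ->
    (forall f, ~ ideal_set I (B f)) ->
  ~ complemented (c0_linfty R I).
Proof.
move=> Junc Bad Bpos [P [Pc PP Prange]].
have PX x : x \in c0_linfty R I -> P x = x.
  move=> xX; have : (range P) x by rewrite Prange.
  by move=> [y _ <-]; exact: (congr1 (fun h => h y) PP).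
have XP x : P x \in c0_linfty R I.
  have : (range P) (P x) by exists x.
  by rewrite Prange.
pose T : {linear linfty R -> linfty R} := (@idfun (linfty R)) \- P.
have Tc : continuous T.
  move=> x; apply: (@cvgB _ _ _ (nbhs x) _ idfun P x (P x)); last exact: Pc.
  exact: cvg_id.
have [x xfin|f Tf] := vanish_almost_disjoint Junc Bad Tc.
  have xX : x \in c0_linfty R I by exact: finite_support_c0.
  by rewrite -[T x]/(x - P x) (PX x xX) subrr.
apply: (Bpos f); apply: (@indic_c0 I).
have /eqP : indic_linfty (B f) - P (indic_linfty (B f)) = 0 := Tf.
by rewrite subr_eq0 => /eqP ->.
Qed.
End whitley.

(** * Meager sets in the Cantor space *)

Lemma nbhs_cylinder (y : cantor_space) n :
  nbhs y [set z : cantor_space | forall i, (i < n)%N -> z i = y i].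
Proof.
elim: n => [|n IH]; first by apply: filterS filterT.
have yn : nbhs y [set z : cantor_space | z n = y n].
  apply: (@proj_continuous nat (fun=> bool) n y [set b | b = y n]).
  exact: discrete_set1.
apply: filterS2 IH yn => z zn zy i; rewrite ltnS leq_eqVlt => /predU1P[->//|].
exact: zn.
Qed.

(** Otherwise points outside U that agree with y on longer and longer initial
    segments would converge to y. *)
Lemma cylinder_basis (y : cantor_space) (U : set cantor_space) : nbhs y U ->
  exists m, forall z : cantor_space, (forall i, (i < m)%N -> z i = y i) -> U z.
Proof.
move=> yU; apply: contrapT => /forallNP noU.
have /choice[z zP] m : exists z : cantor_space,
    (forall i, (i < m)%N -> z i = y i) /\ ~ U z.
  by have /existsNP[z /not_implyP[zy nU]] := noU m; exists z.
have zy : z @ \oo --> y.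
  apply/pointwise_cvgP => i V /nbhs_singleton Vy.
  exists i.+1 => // m /= im; rewrite (zP m).1//.
by have [N _ /(_ N (leqnn N))] := zy _ yU; exact: (zP N).2.
Qed.

Lemma nowhere_dense_avoid (F : set cantor_space) (y : cantor_space) n :
  nowhere_dense F -> exists (y' : cantor_space) m,
    (forall i, (i < n)%N -> y' i = y i) /\
    forall z : cantor_space, (forall i, (i < m)%N -> z i = y' i) -> ~ F z.
Proof.
move=> F0.
have /existsNP[y' /not_implyP[yn nF]] : ~
    [set z : cantor_space | forall i, (i < n)%N -> z i = y i] `<=` closure F.
  move=> yF; have : (closure F)° y by apply: filterS yF (nbhs_cylinder y n).
  by rewrite F0.
have [m mP] : exists m, forall z : cantor_space,
    (forall i, (i < m)%N -> z i = y' i) -> (~` closure F) z.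
  apply: cylinder_basis; apply: open_nbhs_nbhs; split => //.
  exact/closed_openC/closed_closure.
by exists y', m; split=> // z /mP nFz /subset_closure.
Qed.

(** There are finitely many pairs of an initial segment t of length n and an
    index k <= n.  Treating them one after the other, the pattern c is extended
    beyond its current end m so that t followed by c avoids F k. *)
Lemma nowhere_dense_block_pattern (F : nat -> set cantor_space) n :
  (forall i, nowhere_dense (F i)) ->
  exists (c : cantor_space) m, (n < m)%N /\
   forall z : cantor_space, (forall i, (n <= i < m)%N -> z i = c i) ->
   forall k, (k <= n)%N -> ~ F k z.
Proof.
move=> F0.
pose avoids (l : seq (n.-tuple bool * 'I_n.+1)) (c : cantor_space) m :=
  forall tk z, tk \in l -> (forall i, (i < n)%N -> z i = nth false tk.1 i) ->
  (forall i, (n <= i < m)%N -> z i = c i) -> ~ F tk.2 z.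
have [c [m [nm H]]] : exists c m, (n < m)%N /\
    avoids (enum {: n.-tuple bool * 'I_n.+1}) c m.
  elim: (enum _) => [|tk l [c [m [nm IH]]]]; first by exists (fun=> false), n.+1.
  pose y : cantor_space := fun i => if (i < n)%N then nth false tk.1 i else c i.
  have [c' [m' [c'y Fc']]] := nowhere_dense_avoid y m (F0 tk.2).
  exists c', (maxn m m'); split; first by rewrite leq_max nm.
  move=> tk' z; rewrite inE => /predU1P[->|tkl] zt zc.
    apply: Fc' => i im'; have [lin|nli] := ltnP i n.
      by rewrite zt// c'y ?(ltn_trans lin)// /y lin.
    by rewrite zc// nli leq_max im' orbT.
  apply: IH tkl zt _ => i /andP[ni im].
  by rewrite zc ?ni ?leq_max ?im// c'y// /y ltnNge ni.
exists c, m; split => // z zc k kn.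
have kn' : (k < n.+1)%N by [].
apply: (H ([tuple z i | i < n], Ordinal kn') z) => //=; first by rewrite mem_enum.
move=> i lin.
have := tnth_mktuple (fun j : 'I_n => z j) (Ordinal lin).
by rewrite (tnth_nth false) => /esym.
Qed.

(** The blocks are the intervals from u k to u (k+1), and c k is the pattern on
    the k-th block.  Each new block is chosen to defeat F 0, ..., F (u k) for
    every possible past, so a sequence that follows the pattern infinitely
    often avoids every F j. *)
Lemma meager_blocks (A : set cantor_space) : meager A ->
  exists (u : nat -> nat) (c : nat -> nat -> bool),
    (forall k, (u k < u k.+1)%N) /\
    forall z : cantor_space,
      (forall N, exists2 k, (N <= k)%N &
         forall i, (u k <= i < u k.+1)%N -> z i = c k i) -> ~ A z.
Proof.
move=> [F [F0 AF]].
have /choice[cm cmP] n : exists cm : cantor_space * nat, (n < cm.2)%N /\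
   forall z : cantor_space, (forall i, (n <= i < cm.2)%N -> z i = cm.1 i) ->
   forall k, (k <= n)%N -> ~ F k z.
  by have [c [m H]] := nowhere_dense_block_pattern n F0; exists (c, m).
pose u := fix u k := if k is k'.+1 then (cm (u k')).2 else 0%N.
have uS k : (u k < u k.+1)%N by exact: (cmP (u k)).1.
have ku k : (k <= u k)%N by elim: k => // k IH; exact: leq_ltn_trans (uS k).
exists u, (fun k => (cm (u k)).1); split=> // z zc /AF[N _].
have [k Nk zk] := zc N.
exact: (cmP (u k)).2 zk _ (leq_trans Nk (ku k)).
Qed.

(** * Almost disjoint families *)

(** The nodes of the binary tree on the branch f, coded by numbers. *)
Definition branch (f : nat -> bool) : set nat :=
  range (fun n => pickle (mkseq f n)).

Lemma branch_unbounded f N : exists2 k, (N <= k)%N & branch f k.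
Proof.
apply: contrapT => H.
have inj : injective (fun n => pickle (mkseq f n)).
  move=> m n /(pcan_inj pickleK) /(congr1 size).
  by rewrite !size_mkseq.
apply: (@infinite_nat).
apply: (@sub_finite_set _ _ ((fun n => pickle (mkseq f n)) @^-1` `I_N)).
  move=> n _ /=; rewrite ltnNge; apply/negP => Nn; apply: H.
  by exists (pickle (mkseq f n)) => //; exists n.
by apply: finite_preimage (finite_II N) => m n _ _; exact: inj.
Qed.

(** Initial segments longer than a place where f and g differ are distinct. *)
Lemma branch_almost_disjoint f g : f <> g -> finite_set (branch f `&` branch g).
Proof.
move=> /eqP fg; have /existsNP[d dP] : ~ (forall n, f n = g n).
  by move=> E; move/eqP: fg; apply; apply/funext.
apply: (@sub_finite_set _ _ ((fun n => pickle (mkseq f n)) @` `I_d.+1)); last first.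
  exact/finite_image/finite_II.
move=> k [[m _ <-] [n _ /(pcan_inj pickleK) nm]].
exists m => //=; rewrite ltnS leqNgt; apply/negP => dm; apply: dP.
have mn : n = m by move: (congr1 size nm); rewrite !size_mkseq.
by have := congr1 (fun s => nth false s d) nm; rewrite mn !nth_mkseq.
Qed.

(** The set attached to f follows the pattern of [meager_blocks] on the blocks
    numbered by the branch of f, and is empty on all other blocks. *)
Lemma ideal_almost_disjoint_family (I : ideal) : meager (ideal_cantor I) ->
  exists B : (nat -> bool) -> set nat,
    (forall f, ~ ideal_set I (B f)) /\
    (forall f g, f <> g -> finite_set (B f `&` B g)).
Proof.
move=> /meager_blocks[u [c [uS cP]]].
have uW : {homo u : m n / (m <= n)%N}.
  by apply: homo_leq => // [|k]; [exact: leq_trans|exact: ltnW].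
have block_uniq k l i : (u k <= i < u k.+1)%N -> (u l <= i < u l.+1)%N -> k = l.
  move=> /andP[ki ik] /andP[li il]; apply/eqP; rewrite eqn_leq.
  apply/andP; split; rewrite leqNgt; apply/negP => /uW.
    by move=> /leq_ltn_trans/(_ (leq_ltn_trans ki il)); rewrite ltnn.
  by move=> /leq_ltn_trans/(_ (leq_ltn_trans li ik)); rewrite ltnn.
exists (fun f =>
  [set i | exists k, [/\ branch f k, (u k <= i < u k.+1)%N & c k i]]).
split => [f|f g fg].
  set B := (X in ideal_set I X); have BE : [set n | `[< B n >]] = B.
    by apply/seteqP; split => n /= => [/asboolP//|?]; exact/asboolP.
  rewrite -BE; apply: (cP (fun n => `[< B n >])) => N.
  have [k Nk fk] := branch_unbounded f N; exists k => // i ik.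
  apply/asboolP/idP => [[l [_ il]]|ci]; first by rewrite (block_uniq _ _ _ ik il).
  by exists k.
apply: (@sub_finite_set _ _ (\bigcup_(k in branch f `&` branch g) `I_(u k.+1))).
  move=> i [[k [fk ik _]] [l [gl il _]]].
  move: gl; rewrite -(block_uniq _ _ _ ik il) => gk.
  by exists k => //=; case/andP: ik.
apply: bigcup_finite; first exact: branch_almost_disjoint.
by move=> k _; exact: finite_II.
Qed.

(** Cantor's diagonal argument. *)
Lemma uncountable_binary_sequences : ~ countable [set: nat -> bool].
Proof.
move=> /countable_injP[e /in2TT einj].
pose d n := `[< exists2 f, e f = n & ~~ f n >].
have : d (e d) = ~~ d (e d).
  apply/asboolP/idP => [[f /einj -> //]|nd]; by exists d.
by case: (d _).
Qed.

Theorem corollary1p3 (R : realType) (I : ideal)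
    (I_meager : meager (ideal_cantor I)) :
  ~ complemented (c0_linfty R I) /\
  ~ isomorphic (subnormed (c0_linfty R I)) (linfty R).
Proof.
have [B [Bpos Bad]] := ideal_almost_disjoint_family I_meager.
have nc := not_complemented_c0 (R := R) uncountable_binary_sequences Bad Bpos.
by split=> // /isomorphic_complemented.
Qed.
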